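(* Let $Q,R$ be finite quandles. Then for all $n\in\mathbb{N}$ there is an equality of random variables (functions) on $\widehat{B_n}$: $$c_{Q,n}\cdot c_{R,n}=c_{Q\times R,n}.$$
   Context: A quandle is a set $Q$ with a binary operation $(x,y)\mapsto {}^{x}y$ such that (Q1) ${}^{x}x=x$ for all $x$; (Q2) for every $x$ the map $\varphi_x\colon Q\to Q$, $\varphi_x(y)={}^{x}y$, is a bijection; (Q3) ${}^{x}({}^{y}z)={}^{({}^{x}y)}({}^{x}z)$ for all $x,y,z$. A morphism of quandles is a map $f$ with $f({}^{x}y)={}^{f(x)}f(y)$. The product quandle $Q\times R$ has operation ${}^{(x,y)}(x',y')=({}^{x}x',{}^{y}y')$. Oriented (tame) links in $S^3$ are described by diagrams $D$ with a finite set $arcs(D)$ of oriented arcs. For an arc $x$ ending at a crossing as under-strand, $n_x$ is the next arc (the continuation of the under-strand), $c_x$ is the arc passing over $x$ and $n_x$ at that crossing, and $\varepsilon_x\in\{\pm1\}$ is the orientation of the crossing: rotating the picture so that both strands point downwards, $\varepsilon_x=1$ if the over-strand goes from upper left to lower right, and $\varepsilon_x=-1$ if it goes from upper right to lower left. The fundamental quandle $Q_L$ of the link $L$ is the quandle generated by $arcs(D)$ subject to the relations $\varphi_{c_x}^{\varepsilon_x}(x)=n_x$; up to isomorphism it does not depend on the diagram $D$ of $L$. The set of $Q$-colorings of $L$ is $\mathrm{Col}_Q(L)=\mathrm{Hom}(Q_L,Q)$ (quandle morphisms); equivalently, maps $f\colon arcs(D)\to Q$ with $\varphi_{f(c_x)}^{\varepsilon_x}(f(x))=f(n_x)$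 at every crossing. It is finite when $Q$ is finite. $B_n$ is the Artin braid group on $n$ strands, with generators $\sigma_1,\dots,\sigma_{n-1}$ and relations $\sigma_i\sigma_{i+1}\sigma_i=\sigma_{i+1}\sigma_i\sigma_{i+1}$ and $[\sigma_i,\sigma_j]=1$ for $|i-j|\ge2$. Braids are oriented downwards; in $\sigma_i$ the strand starting on top at position $i$ passes over the strand starting at position $i+1$. The closure $\overline\sigma$ is the oriented link obtained by joining the bottom endpoints of $\sigma$ to the corresponding top endpoints without introducing crossings. $\widehat{B_n}$ is the profinite completion of $B_n$. For a finite quandle $Q$, the function $B_n\to\mathbb{N}$, $\sigma\mapsto|\mathrm{Col}_Q(\overline\sigma)|$, factors through a finite quotient of $B_n$, so it extends uniquely to a continuous (locally constant) function $c_{Q,n}\colon\widehat{B_n}\to\mathbb{N}$, viewed as a random variable with respect to Haar measure. *)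

(* Defs.v *)
From HB Require Import structures.
From mathcomp Require Import all_boot finmap all_classical topology.

Set Implicit Arguments.
Unset Strict Implicit.
Unset Printing Implicit Defensive.

Local Open Scope classical_set_scope.
Local Open Scope card_scope.
Local Open Scope quotient_scope.

Reserved Notation "x |> y" (at level 40, left associativity).

HB.mixin Record isQuandle T := {
  qop : T -> T -> T;
  qopxx : forall x, qop x x = x;
  qop_bij : forall x, bijective (qop x);
  qopD : forall x y z, qop x (qop y z) = qop (qop x y) (qop x z)
}.

#[short(type="quandleType")]
HB.structure Definition Quandle := {T of isQuandle T}.

#[short(type="finQuandleType")]
HB.structure Definition FinQuandle := {T of isQuandle T & Finite T}.

Notation "x |> y" := (qop x y).

Definition quandle_morphism (Q R : quandleType) (f : Q -> R) : Prop :=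
  forall x y, f (x |> y) = f x |> f y.

Section ProductQuandle.
Variables Q R : quandleType.

Definition prod_qop (p q : Q * R) : Q * R := (p.1 |> q.1, p.2 |> q.2).

Fact prod_qopxx p : prod_qop p p = p.
Proof. by case: p => x y; rewrite /prod_qop /= !qopxx. Qed.

Fact prod_qop_bij p : bijective (prod_qop p).
Proof.
have [[f fK Kf] [g gK Kg]] := (qop_bij p.1, qop_bij p.2).
by exists (fun q => (f q.1, g q.2)) => -[x y];
  rewrite /prod_qop /= ?fK ?gK ?Kf ?Kg.
Qed.

Fact prod_qopD p q r :
  prod_qop p (prod_qop q r) = prod_qop (prod_qop p q) (prod_qop p r).
Proof. by rewrite /prod_qop /= -!qopD. Qed.

HB.instance Definition _ :=
  isQuandle.Build (Q * R)%type prod_qopxx prod_qop_bij prod_qopD.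

End ProductQuandle.

HB.instance Definition _ (Q R : finQuandleType) := Quandle.on (Q * R)%type.

(* Quandles given by generators and relations: [QDiv t] stands for the inverse
   of the bijection [QOp t]. *)

Inductive qterm (A : Type) : Type :=
| QGen of A
| QOp of qterm A & qterm A
| QDiv of qterm A & qterm A.

HB.instance Definition _ (A : Type) := gen_eqMixin (qterm A).
HB.instance Definition _ (A : Type) := gen_choiceMixin (qterm A).

Section Presentation.
Variables (A : Type) (rels : qterm A -> qterm A -> Prop).

Inductive qcongr : qterm A -> qterm A -> Prop :=
| qc_refl t : qcongr t t
| qc_sym t u : qcongr t u -> qcongr u t
| qc_trans t u v : qcongr t u -> qcongr u v -> qcongr t v
| qc_op t t' u u' : qcongr t t' -> qcongr u u' -> qcongr (QOp t u) (QOp t' u')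
| qc_div t t' u u' :
    qcongr t t' -> qcongr u u' -> qcongr (QDiv t u) (QDiv t' u')
| qc_xx t : qcongr (QOp t t) t
| qc_opK t u : qcongr (QDiv t (QOp t u)) u
| qc_divK t u : qcongr (QOp t (QDiv t u)) u
| qc_D t u v : qcongr (QOp t (QOp u v)) (QOp (QOp t u) (QOp t v))
| qc_rel t u : rels t u -> qcongr t u.

Definition qcongrb (t u : qterm A) : bool := `[< qcongr t u >].

Fact qcongrb_refl : reflexive qcongrb.
Proof. by move=> t; apply/asboolP/qc_refl. Qed.

Fact qcongrb_sym : symmetric qcongrb.
Proof. by move=> t u; apply/asboolP/asboolP => /qc_sym. Qed.

Fact qcongrb_trans : transitive qcongrb.
Proof.
by move=> u t v /asboolP tu /asboolP uv; apply/asboolP/(qc_trans tu uv).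
Qed.

Canonical qcongr_equiv :=
  EquivRel qcongrb qcongrb_refl qcongrb_sym qcongrb_trans.

Definition presented_quandle := {eq_quot qcongr_equiv}.

HB.instance Definition _ := Choice.on presented_quandle.
HB.instance Definition _ := EqQuotient.on presented_quandle.

Lemma qcongrP t u :
  qcongr t u <-> \pi_presented_quandle t = \pi_presented_quandle u.
Proof.
split=> [tu|/eqP]; last by rewrite piE /= => /asboolP.
by apply/eqP; rewrite piE /=; apply/asboolP.
Qed.

Lemma qcongr_repr t : qcongr (repr (\pi_presented_quandle t)) t.
Proof. by apply/qcongrP; rewrite reprK. Qed.

Definition pq_op (x y : presented_quandle) : presented_quandle :=
  \pi_presented_quandle (QOp (repr x) (repr y)).

Definition pq_div (x y : presented_quandle) : presented_quandle :=
  \pi_presented_quandle (QDiv (repr x) (repr y)).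

Lemma pq_opE t u :
  pq_op (\pi_presented_quandle t) (\pi_presented_quandle u) =
  \pi_presented_quandle (QOp t u).
Proof. by apply/qcongrP; apply: qc_op; apply: qcongr_repr. Qed.

Lemma pq_divE t u :
  pq_div (\pi_presented_quandle t) (\pi_presented_quandle u) =
  \pi_presented_quandle (QDiv t u).
Proof. by apply/qcongrP; apply: qc_div; apply: qcongr_repr. Qed.

Fact pq_opxx x : pq_op x x = x.
Proof. by rewrite -[x]reprK pq_opE; apply/qcongrP/qc_xx. Qed.

Fact pq_op_bij x : bijective (pq_op x).
Proof.
exists (pq_div x) => y; rewrite -[x]reprK -[y]reprK.
  by rewrite pq_opE pq_divE; apply/qcongrP/qc_opK.
by rewrite pq_divE pq_opE; apply/qcongrP/qc_divK.
Qed.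

Fact pq_opD x y z : pq_op x (pq_op y z) = pq_op (pq_op x y) (pq_op x z).
Proof.
rewrite -[x]reprK -[y]reprK -[z]reprK !(pq_opE (repr _) (repr _)) !pq_opE.
by apply/qcongrP/qc_D.
Qed.

HB.instance Definition _ :=
  isQuandle.Build presented_quandle pq_opxx pq_op_bij pq_opD.

End Presentation.

(* Oriented link diagrams, through their incidence data: at each crossing, the
   incoming and outgoing under-arcs, the over-arc, and the orientation
   ([true] for +1). The planar embedding plays no role in what follows. *)

Record link_diagram := LinkDiagram {
  arc : finType;
  crossing : finType;
  under_in : crossing -> arc;
  under_out : crossing -> arc;
  over_arc : crossing -> arc;
  positive : crossing -> bool
}.

Definition wirtinger (D : link_diagram) (t u : qterm (arc D)) : Prop :=
  exists x : crossing D,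
    t = (if positive x then @QOp _ else @QDiv _)
          (QGen (over_arc x)) (QGen (under_in x)) /\
    u = QGen (under_out x).

Definition fundamental_quandle (D : link_diagram) : quandleType :=
  presented_quandle (@wirtinger D).

Definition Col (Q : quandleType) (D : link_diagram) :
    set (fundamental_quandle D -> Q) :=
  [set f | quandle_morphism f].
Arguments Col : clear implicits.

(* [fset_set] would be empty on an infinite set; here [Col Q D] is finite, as a
   morphism is determined by its values on the arcs. *)
Definition card_Col (Q : finQuandleType) (D : link_diagram) : nat :=
  #|` fset_set (Col Q D)|.

(* The Artin presentation on words in the letters (i, true), which stands for
   sigma_(i+1), and (i, false), which stands for its inverse. *)

Section Braids.
Variable n : nat.

Definition braid_letter : Type := 'I_n.-1 * bool.
Definition braid_word : Type := seq braid_letter.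

HB.instance Definition _ := Choice.on braid_letter.
HB.instance Definition _ := Choice.on braid_word.

Inductive braid_eq : braid_word -> braid_word -> Prop :=
| be_refl u : braid_eq u u
| be_sym u v : braid_eq u v -> braid_eq v u
| be_trans u v w : braid_eq u v -> braid_eq v w -> braid_eq u w
| be_cat u u' v v' : braid_eq u u' -> braid_eq v v' ->
    braid_eq (u ++ v) (u' ++ v')
| be_inv i b : braid_eq [:: (i, b); (i, ~~ b)] [::]
| be_braid (i j : 'I_n.-1) : j = i.+1 :> nat ->
    braid_eq [:: (i, true); (j, true); (i, true)]
             [:: (j, true); (i, true); (j, true)]
| be_comm (i j : 'I_n.-1) : i.+2 <= j ->
    braid_eq [:: (i, true); (j, true)] [:: (j, true); (i, true)].

Definition braid_eqb (u v : braid_word) : bool := `[< braid_eq u v >].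

Fact braid_eqb_refl : reflexive braid_eqb.
Proof. by move=> u; apply/asboolP/be_refl. Qed.

Fact braid_eqb_sym : symmetric braid_eqb.
Proof. by move=> u v; apply/asboolP/asboolP => /be_sym. Qed.

Fact braid_eqb_trans : transitive braid_eqb.
Proof.
by move=> v u w /asboolP uv /asboolP vw; apply/asboolP/(be_trans uv vw).
Qed.

Canonical braid_equiv :=
  EquivRel braid_eqb braid_eqb_refl braid_eqb_sym braid_eqb_trans.

Definition braid := {eq_quot braid_equiv}.

HB.instance Definition _ := Choice.on braid.
HB.instance Definition _ := EqQuotient.on braid.

Lemma braid_eqP u v : braid_eq u v <-> \pi_braid u = \pi_braid v.
Proof.
split=> [uv|/eqP]; last by rewrite piE /= => /asboolP.
by apply/eqP; rewrite piE /=; apply/asboolP.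
Qed.

Lemma braid_eq_repr u : braid_eq (repr (\pi_braid u)) u.
Proof. by apply/braid_eqP; rewrite reprK. Qed.

Definition braid_word_inv (u : braid_word) : braid_word :=
  rev [seq (l.1, ~~ l.2) | l <- u].

Definition braid_one : braid := \pi_braid [::].
Definition braid_mul (x y : braid) : braid := \pi_braid (repr x ++ repr y).
Definition braid_inv (x : braid) : braid := \pi_braid (braid_word_inv (repr x)).

Lemma braid_mulE u v :
  braid_mul (\pi_braid u) (\pi_braid v) = \pi_braid (u ++ v).
Proof. by apply/braid_eqP; apply: be_cat; apply: braid_eq_repr. Qed.

Lemma be_mulV u : braid_eq (u ++ braid_word_inv u) [::].
Proof.
elim: u => [|[i b] u IHu]; first exact: be_refl.
rewrite /braid_word_inv /= rev_cons -cats1 catA -cat1s.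
apply: be_trans (be_inv i b); apply: (be_cat (be_refl [:: _])).
exact: be_cat IHu (be_refl [:: _]).
Qed.

Lemma braid_word_invK : involutive braid_word_inv.
Proof.
move=> u; rewrite /braid_word_inv map_rev revK -map_comp.
by rewrite -[RHS]map_id; apply: eq_map => -[i b]; rewrite /= negbK.
Qed.

Lemma be_mulVl u : braid_eq (braid_word_inv u ++ u) [::].
Proof. by rewrite -{2}(braid_word_invK u); apply: be_mulV. Qed.

Fact braid_mulA : associative braid_mul.
Proof.
move=> x y z; rewrite -[x]reprK -[y]reprK -[z]reprK.
by rewrite !(braid_mulE (repr _) (repr _)) !braid_mulE catA.
Qed.

Fact braid_mul1 : left_id braid_one braid_mul.
Proof. by move=> x; rewrite -[x]reprK braid_mulE. Qed.

Fact braid_mulx1 : right_id braid_one braid_mul.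
Proof. by move=> x; rewrite -[x]reprK braid_mulE cats0. Qed.

Fact braid_mulV : left_inverse braid_one braid_inv braid_mul.
Proof.
by move=> x; rewrite -{2}[x]reprK braid_mulE; apply/braid_eqP/be_mulVl.
Qed.

Fact braid_mulxV : right_inverse braid_one braid_inv braid_mul.
Proof.
by move=> x; rewrite -{1}[x]reprK braid_mulE; apply/braid_eqP/be_mulV.
Qed.

HB.instance Definition _ := isGroup.Build braid
  braid_mulA braid_mul1 braid_mulx1 braid_mulV braid_mulxV.

(* Closure of a braid word w, read from top to bottom. The strands are cut into
   segments (k, i), where k is a level (0 at the top, size w at the bottom) and
   i a position; the letter number k acts between levels k and k+1. *)

Fact left_pos_subproof (i : 'I_n.-1) : i < n.
Proof. by apply: leq_trans (ltn_ord i) _; rewrite leq_pred. Qed.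
Definition left_pos (i : 'I_n.-1) : 'I_n := Ordinal (left_pos_subproof i).

Fact right_pos_subproof (i : 'I_n.-1) : i.+1 < n.
Proof. by case: i; case: (n). Qed.
Definition right_pos (i : 'I_n.-1) : 'I_n := Ordinal (right_pos_subproof i).

(* In (i, true) the over-strand goes from upper left to lower right; in its
   inverse it goes from upper right to lower left. *)
Definition over_top (l : braid_letter) :=
  if l.2 then left_pos l.1 else right_pos l.1.
Definition over_bottom (l : braid_letter) :=
  if l.2 then right_pos l.1 else left_pos l.1.
Definition under_top := over_bottom.
Definition under_bottom := over_top.

Section Closure.
Variable w : braid_word.

Definition segment : Type := 'I_(size w).+1 * 'I_n.

HB.instance Definition _ := Finite.on segment.

Definition letter_at (k : 'I_(size w)) : braid_letter := tnth (in_tuple w) k.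
Definition above (k : 'I_(size w)) : 'I_(size w).+1 := widen_ord (leqnSn _) k.
Definition below (k : 'I_(size w)) : 'I_(size w).+1 := lift ord0 k.

Inductive glued : segment -> segment -> Prop :=
| glue_over k :
    glued (above k, over_top (letter_at k)) (below k, over_bottom (letter_at k))
| glue_straight k i :
    i != over_top (letter_at k) -> i != under_top (letter_at k) ->
    glued (above k, i) (below k, i)
| glue_closure i : glued (ord_max, i) (ord0, i).

Definition same_arc : rel segment :=
  connect (fun x y => `[< glued x y \/ glued y x >]).

(* An arc of the closure is a maximal union of consecutive segments that are not
   separated by an under-crossing. *)
Definition arc_set (x : segment) : {set segment} :=
  finset (fun y => same_arc x y).
Definition closure_arc : finType :=
  {A : {set segment} | [exists x, A == arc_set x]}.

Fact arc_of_subproof x : [exists y, arc_set x == arc_set y].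
Proof. by apply/existsP; exists x. Qed.
Definition arc_of (x : segment) : closure_arc :=
  exist _ (arc_set x) (arc_of_subproof x).

Definition braid_closure : link_diagram := {|
  arc := closure_arc;
  crossing := 'I_(size w);
  under_in k := arc_of (above k, under_top (letter_at k));
  under_out k := arc_of (below k, under_bottom (letter_at k));
  over_arc k := arc_of (above k, over_top (letter_at k));
  positive k := (letter_at k).2
|}.

End Closure.

End Braids.

(* Profinite completion: the space of coherent families of cosets of the normal
   subgroups of finite index, with the topology induced by the product of the
   discrete topologies. *)

Definition left_coset (G : groupType) (N : set G) (g : G) : set G :=
  [set (g * h)%g | h in N].

Record fin_normal (G : groupType) := FinNormal {
  fin_normal_set :> set G;
  fin_normal1 : fin_normal_set 1%g;
  fin_normalM : forall x y,
    fin_normal_set x -> fin_normal_set y -> fin_normal_set (x * y)%g;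
  fin_normalV : forall x, fin_normal_set x -> fin_normal_set (x^-1)%g;
  fin_normalJ : forall x y, fin_normal_set x -> fin_normal_set (x ^ y)%g;
  fin_normal_index : finite_set (range (left_coset fin_normal_set))
}.

HB.instance Definition _ (G : groupType) := gen_eqMixin (fin_normal G).

Section Profinite.
Variable G : groupType.

Definition cosets (N : fin_normal G) : Type :=
  discrete_topology (range (left_coset N)).

HB.instance Definition _ (N : fin_normal G) :=
  DiscreteTopology.on (cosets N).

Definition coset_set (N : fin_normal G) (C : cosets N) : set G := set_val C.

Definition coherent : set (prod_topology cosets) :=
  [set x | forall N M : fin_normal G,
     N `<=` M -> coset_set (x N) `<=` coset_set (x M)].

Definition profinite : Type := coherent.

HB.instance Definition _ := Topological.on profinite.

Definition to_coset (N : fin_normal G) (g : G) : cosets N :=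
  exist _ (left_coset N g) (mem_set (imageT (left_coset N) g)).

Fact to_profinite_subproof g : coherent (fun N => to_coset N g).
Proof. by move=> N M NM _ [h Nh <-]; exists h => //; apply: NM. Qed.

Definition to_profinite (g : G) : profinite :=
  exist (fun x => x \in coherent) _ (mem_set (@to_profinite_subproof g)).

Definition component (N : fin_normal G) (x : profinite) : cosets N :=
  set_val x N.

Lemma component_continuous N : continuous (@component N).
Proof.
move=> x.
apply: (@cvg_comp _ _ _ (fun y : profinite => set_val y)
  (@proj _ cosets N) _ (nbhs (set_val x : prod_topology cosets))).
  exact: initial_continuous.
exact: proj_continuous.
Qed.

End Profinite.

(* The continuous extension of the number of colorings of the closure. Asking
   for the equation for all words w, rather than for one representative of each
   braid, contains the invariance of that number under the braid relations. *)

Definition is_extension (Q : finQuandleType) (n : nat)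
    (c : profinite (braid n) -> nat) : Prop :=
  continuous c /\
  forall w : braid_word n,
    c (to_profinite (\pi_(braid n) w)) = card_Col Q (braid_closure w).

(* Existence of the extension: the number of colorings of the closure of w is
   the number of fixed points of w acting on n-tuples of colors. *)

Section QuandleInverse.
Variable Q : quandleType.

Fact qdiv_subproof (x : Q) :
  exists g : Q -> Q, cancel (qop x) g /\ cancel g (qop x).
Proof. by have [g] := qop_bij x; exists g. Qed.

Definition qdiv (x : Q) : Q -> Q := sval (cid (qdiv_subproof x)).

Lemma qopK x : cancel (qop x) (qdiv x).
Proof. by rewrite /qdiv; case: cid => g []. Qed.

Lemma qdivK x : cancel (qdiv x) (qop x).
Proof. by rewrite /qdiv; case: cid => g []. Qed.

End QuandleInverse.

Section BraidAction.
Variables (Q : quandleType) (n : nat).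
Implicit Types (v : {ffun 'I_n -> Q}) (w : braid_word n) (l : braid_letter n).

Definition act_letter v l : {ffun 'I_n -> Q} :=
  [ffun j => if j == over_bottom l then v (over_top l) else
    if j == under_bottom l then
      (if l.2 then @qop Q else @qdiv Q) (v (over_top l)) (v (under_top l))
    else v j].

Definition act w v := foldl act_letter v w.

Lemma right_neq_left (i : 'I_n.-1) : (right_pos i == left_pos i) = false.
Proof. by rewrite -val_eqE /= gtn_eqF. Qed.

Lemma act_braid_eq u w : braid_eq u w -> act u =1 act w.
Proof.
elim=> {u w}.
- by [].
- by move=> u w _ + v => ->.
- by move=> u w z _ uw _ wz v; rewrite uw.
- move=> u u' w w' _ uu' _ ww' v.
  by rewrite /act !foldl_cat -!/(act _ _) uu' ww'.
- move=> i b v; apply/ffunP => j; rewrite /= !ffunE.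
  rewrite /over_bottom /under_bottom /over_top /under_top /over_bottom.
  have rl := right_neq_left i.
  have lr : (left_pos i == right_pos i) = false by rewrite eq_sym.
  by case: b => /=; rewrite !eqxx ?rl ?lr /=;
    do 2?[case: eqP => [->|_] //=]; rewrite ?qopK ?qdivK.
- move=> i j ij v.
  have lr (i' : 'I_n.-1) := right_neq_left i'.
  have rl (i' : 'I_n.-1) : (left_pos i' == right_pos i') = false.
    by rewrite eq_sym lr.
  have e : left_pos j = right_pos i by apply: val_inj.
  have f1 : (right_pos j == left_pos i) = false.
    by rewrite -val_eqE /= ij gtn_eqF.
  have f2 : (right_pos j == right_pos i) = false.
    by rewrite -val_eqE /= ij gtn_eqF.
  have f3 : (left_pos i == right_pos j) = false by rewrite eq_sym.
  have f4 : (right_pos i == right_pos j) = false by rewrite eq_sym.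
  apply/ffunP => k; rewrite /= !ffunE.
  rewrite /over_bottom /under_bottom /over_top /under_top /over_bottom /= e.
  rewrite !(eqxx, lr, rl, f1, f2, f3, f4) /=.
  by do 3?[case: (k =P _) => [->|_]];
    rewrite ?(eqxx, lr, rl, f1, f2, f3, f4) //= -?qopD //;
    case: (k == right_pos j).
- move=> i j ij v.
  have lr (i' : 'I_n.-1) := right_neq_left i'.
  have rl (i' : 'I_n.-1) : (left_pos i' == right_pos i') = false.
    by rewrite eq_sym lr.
  have ij' := ltnW ij; have ij'' := ltnW ij'.
  have f1 : (right_pos j == left_pos i) = false.
    by rewrite -val_eqE /= gtn_eqF // ltnS ltnW.
  have f2 : (right_pos j == right_pos i) = false.
    by rewrite -val_eqE /= gtn_eqF.
  have f3 : (left_pos i == right_pos j) = false by rewrite eq_sym.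
  have f4 : (right_pos i == right_pos j) = false by rewrite eq_sym.
  have f5 : (left_pos j == left_pos i) = false.
    by rewrite -val_eqE /= gtn_eqF.
  have f6 : (left_pos j == right_pos i) = false.
    by rewrite -val_eqE /= gtn_eqF.
  have f7 : (left_pos i == left_pos j) = false by rewrite eq_sym.
  have f8 : (right_pos i == left_pos j) = false by rewrite eq_sym.
  apply/ffunP => k; rewrite /= !ffunE.
  rewrite /over_bottom /under_bottom /over_top /under_top /over_bottom /=.
  rewrite !(eqxx, lr, rl, f1, f2, f3, f4, f5, f6, f7, f8) /=.
  by do 4?[case: (k =P _) => [->|_]];
    rewrite ?(eqxx, lr, rl, f1, f2, f3, f4, f5, f6, f7, f8) //=.

Qed.

Lemma act_repr w : act (repr (\pi_(braid n) w)) =1 act w.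
Proof. exact/act_braid_eq/braid_eq_repr. Qed.

End BraidAction.

Lemma card_fset_set_finType (S : choiceType) (T : finType) (A : set S)
    (P : pred T) (f : S -> T) :
  {in A &, injective f} -> f @` A = [set x | P x] -> #|` fset_set A| = #|P|.
Proof.
move=> f_inj fA.
have Pfin : finite_set [set x | P x] by exact: finite_finset.
have /finite_setP[n Pn] := Pfin.
have An : A #= `I_n.
  by apply: card_eq_trans Pn; rewrite -fA card_eq_sym; exact: inj_card_eq.
rewrite (card_fset_set An) -(card_fset_set Pn).
have -> : [set x | P x] = [set` [fset x | x in P]%fset].
  by apply/seteqP; split=> x; rewrite /= in_fset.
by rewrite set_fsetK card_imfset //= -cardE.
Qed.

Section Colorings.
Variable Q : quandleType.

Definition signed_op (b : bool) : Q -> Q -> Q := if b then @qop Q else @qdiv Q.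

Section Diagram.
Variable D : link_diagram.
Local Notation gen a := (\pi_(fundamental_quandle D) (@QGen (arc D) a)).

Definition coloring (f : arc D -> Q) : Prop := forall x : crossing D,
  signed_op (positive x) (f (over_arc x)) (f (under_in x)) = f (under_out x).

Fixpoint qeval (f : arc D -> Q) (t : qterm (arc D)) : Q :=
  match t with
  | QGen a => f a
  | QOp t u => qeval f t |> qeval f u
  | QDiv t u => qdiv (qeval f t) (qeval f u)
  end.

Lemma qeval_congr f t u :
  coloring f -> qcongr (@wirtinger D) t u -> qeval f t = qeval f u.
Proof.
move=> fcol; elim=> {t u} //=.
- by move=> t u v _ -> _ ->.
- by move=> t t' u u' _ -> _ ->.
- by move=> t t' u u' _ -> _ ->.
- by move=> t; rewrite qopxx.
- by move=> t u; rewrite qopK.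
- by move=> t u; rewrite qdivK.
- by move=> t u v; rewrite qopD.
- move=> _ _ [x [-> ->]] /=; rewrite -fcol /signed_op.
  by case: positive.
Qed.

Lemma ColE g t : Col Q D g ->
  g (\pi_(fundamental_quandle D) t) = qeval (fun a => g (gen a)) t.
Proof.
move=> gmor; elim: t => //= [t <- u <-|t <- u <-].
  by rewrite -gmor; congr g; rewrite [RHS]pq_opE.
apply: (can_inj (qopK (g (\pi t)))); rewrite qdivK -gmor; congr g.
by rewrite [LHS]pq_opE; apply/qcongrP/qc_divK.
Qed.

Lemma Col_coloring g : Col Q D g -> coloring (fun a => g (gen a)).
Proof.
move=> gmor x; have : qcongr (@wirtinger D)
    ((if positive x then @QOp _ else @QDiv _)
       (QGen (over_arc x)) (QGen (under_in x))) (QGen (under_out x)).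
  by apply: qc_rel; exists x.
move=> /qcongrP/(congr1 g); move=> <-; rewrite [RHS]ColE //.
by rewrite /signed_op; case: positive.
Qed.

Lemma Col_ext g h : Col Q D g -> Col Q D h ->
  (forall a, g (gen a) = h (gen a)) -> g = h.
Proof.
move=> gmor hmor gh; apply/funext => x; rewrite -[x]reprK !ColE //.
by congr qeval; apply/funext.
Qed.

Lemma coloring_Col f : coloring f ->
  exists2 g, Col Q D g & forall a, g (gen a) = f a.
Proof.
move=> fcol; exists (fun x => qeval f (repr x)) => [x y|a].
  by rewrite -/(qeval f (QOp _ _));
    apply: (qeval_congr fcol); exact: qcongr_repr.
by rewrite -[RHS]/(qeval f (QGen a));
    apply: (qeval_congr fcol); exact: qcongr_repr.
Qed.

End Diagram.

Section Closure.
Variables (n : nat) (w : braid_word n).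
Implicit Types (v : {ffun 'I_n -> Q}) (f : arc (braid_closure w) -> Q).

Definition level_colors v (x : segment w) : Q := act (take x.1 w) v x.2.

Lemma letter_atE (k : 'I_(size w)) d : letter_at k = nth d w k.
Proof. by rewrite /letter_at (tnth_nth d). Qed.

Lemma act_below v (k : 'I_(size w)) :
  act (take (below k) w) v = act_letter (act (take k w) v) (letter_at k).
Proof.
rewrite /act lift0 (take_nth (letter_at k)) // -cats1 foldl_cat /=.
by rewrite -letter_atE.
Qed.

Lemma top_neq_bottom (l : braid_letter n) :
  (over_top l == over_bottom l) = false.
Proof.
case: l => i [] /=; rewrite /over_top /over_bottom /= ?right_neq_left //.
by rewrite eq_sym right_neq_left.
Qed.

Lemma same_arc_glued (x y : segment w) : glued x y -> arc_of x = arc_of y.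
Proof.
move=> xy; apply/val_inj/setP => z; rewrite !inE /=.
apply: same_connect; last by apply: connect1; apply/asboolP; left.
by apply: sym_connect_sym => a b; apply/asboolP/asboolP => -[]; by [left|right].
Qed.

Lemma arc_of_levels f v : coloring f ->
  (forall i, f (arc_of (ord0, i)) = v i) ->
  forall x, f (arc_of x) = level_colors v x.
Proof.
move=> fcol fv [[k kw] i]; elim: k kw i => [|k IHk] kw i.
  rewrite /level_colors take0 /= -fv.
  by congr (f (arc_of (_, _))); apply: val_inj.
pose k' : 'I_(size w) := Ordinal (kw : k < size w).
have ek : Ordinal kw = below k' by apply: val_inj; rewrite /= /bump.
have IH j : f (arc_of (above k', j)) = act (take k w) v j.
  by rewrite -[RHS](IHk (ltnW kw)); congr (f (arc_of (_, _))); apply: val_inj.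
rewrite ek /level_colors act_below ffunE -!IH.
have := fcol k'; rewrite /= /under_bottom => fk.
case: eqP => [->|/eqP ib].
  by rewrite (same_arc_glued (glue_over k')).
case: eqP => [->|/eqP it]; first by rewrite -fk.
by rewrite -(same_arc_glued (glue_straight it ib)).
Qed.

Lemma level_colors_glued v x y : act w v = v ->
  glued x y -> level_colors v x = level_colors v y.
Proof.
move=> vw; case=> {x y}.
- by move=> k; rewrite /level_colors /= act_below ffunE eqxx.
- move=> k i it ib; rewrite /level_colors /= act_below ffunE.
  by rewrite /under_bottom (negPf it) -/(under_top _) (negPf ib).
- by move=> i; rewrite /level_colors /= take_size take0 vw.
Qed.

Lemma level_colors_arc v x y : act w v = v ->
  arc_of x = arc_of y -> level_colors v x = level_colors v y.
Proof.
move=> vw /(congr1 val)/setP/(_ y); rewrite !inE /same_arc connect0.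
move=> /connectP[p + ->] {y}; elim: p x => //= z p IHp x.
move=> /andP[/asboolP xz /IHp <-].
by case: xz => /level_colors_glued ->.
Qed.

Lemma arc_of_surj (A : closure_arc w) : exists x, A = arc_of x.
Proof.
by case: A => A PA; have /existsP[x /eqP Ax] := PA; exists x; apply: val_inj.
Qed.

Lemma coloring_ext f (g : arc (braid_closure w) -> Q) :
  coloring f -> coloring g ->
  (forall i, f (arc_of (ord0, i)) = g (arc_of (ord0, i))) -> f = g.
Proof.
move=> fcol gcol fg; apply/funext => A; have [x ->] := arc_of_surj A.
pose v := [ffun i => g (arc_of (ord0, i))].
by rewrite !(@arc_of_levels _ v) // => i; rewrite ffunE.
Qed.

Lemma coloring_fixed f : coloring f ->
  let v := [ffun i => f (arc_of (ord0, i))] in act w v = v.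
Proof.
move=> fcol v; have fv i : f (arc_of (ord0, i)) = v i by rewrite ffunE.
apply/ffunP => i; rewrite -fv -(same_arc_glued (glue_closure w i)).
by rewrite (arc_of_levels fcol fv) /level_colors take_size.
Qed.

Lemma fixed_coloring v : act w v = v ->
  exists2 f : arc (braid_closure w) -> Q, coloring f &
    forall i, f (arc_of (ord0, i)) = v i.
Proof.
move=> vw; exists (fun A => level_colors v (sval (cid (arc_of_surj A)))).
  have E x : level_colors v (sval (cid (arc_of_surj (arc_of x)))) =
             level_colors v x.
    by case: cid => y /= /esym; exact: level_colors_arc.
  move=> k; rewrite /= !E /level_colors /= act_below !ffunE.
  rewrite /under_bottom top_neq_bottom eqxx.
  by rewrite /signed_op.
move=> i; case: cid => y /= /esym/(level_colors_arc vw) ->.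
by rewrite /level_colors take0.
Qed.

End Closure.

End Colorings.

Lemma card_Col_closure (Q : finQuandleType) n (w : braid_word n) :
  card_Col Q (braid_closure w) =
  #|[pred v : {ffun 'I_n -> Q} | act w v == v]|.
Proof.
pose D := braid_closure w.
pose F (g : fundamental_quandle D -> Q) : {ffun 'I_n -> Q} :=
  [ffun i =>
    g (\pi_(fundamental_quandle D) (@QGen (arc D) (arc_of (ord0, i))))].
apply: (@card_fset_set_finType _ _ _ _ F).
  move=> g h /set_mem Cg /set_mem Ch gh; apply: Col_ext => // a.
  apply: (congr1 (@^~ a) (coloring_ext (Col_coloring Cg) (Col_coloring Ch) _)).
  move=> i; by have /ffunP/(_ i) := gh; rewrite !ffunE.
apply/seteqP; split=> [_ [g Cg <-]|v /eqP].
  by apply/eqP; have := coloring_fixed (Col_coloring Cg).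
move=> /fixed_coloring[f fcol fv]; have [g Cg gf] := coloring_Col fcol.
by exists g => //; apply/ffunP => i; rewrite ffunE gf fv.
Qed.

Section Extension.
Variables (Q : finQuandleType) (n : nat).
Implicit Types (x y : braid n) (v : {ffun 'I_n -> Q}).

Definition braid_act x : {ffun 'I_n -> Q} -> {ffun 'I_n -> Q} := act (repr x).

Lemma braid_act_pi w : braid_act (\pi_(braid n) w) =1 act w.
Proof. exact: act_repr. Qed.

Lemma braid_actM x y v : braid_act (x * y)%g v = braid_act y (braid_act x v).
Proof. by rewrite [LHS]braid_act_pi /act foldl_cat. Qed.

Lemma braid_act1 v : braid_act 1%g v = v.
Proof. by rewrite [LHS]braid_act_pi. Qed.

Definition act_kernel : set (braid n) := [set x | forall v, braid_act x v = v].

Lemma act_kernelM x k : act_kernel k -> braid_act (x * k)%g =1 braid_act x.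
Proof. by move=> kK v; rewrite braid_actM kK. Qed.

Lemma act_kernelV x : act_kernel x -> act_kernel (x^-1)%g.
Proof. by move=> xK v; rewrite -{1}[v]xK -braid_actM mulgV braid_act1. Qed.

Lemma act_kernelJ x y : act_kernel x -> act_kernel (x ^ y)%g.
Proof.
by move=> xK v; rewrite conjgE !braid_actM xK -braid_actM mulVg braid_act1.
Qed.

Lemma act_kernel_index : finite_set (range (left_coset act_kernel)).
Proof.
pose e x := [ffun v => braid_act x v].
have eP x y : e x = e y -> left_coset act_kernel x `<=` left_coset act_kernel y.
  move=> /ffunP exy _ [k kK <-]; exists (y^-1 * (x * k))%g; last exact: mulVKg.
  move=> v; rewrite !braid_actM kK.
  have := exy (braid_act y^-1 v)%g; rewrite !ffunE => ->.
  by rewrite -braid_actM mulVg braid_act1.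
pose f (a : {ffun {ffun 'I_n -> Q} -> {ffun 'I_n -> Q}}) : set (braid n) :=
  [set z | exists2 x, e x = a & left_coset act_kernel x z].
apply: (@sub_finite_set _ _ (range f)); last exact/finite_image/finite_finset.
move=> _ [x _ <-]; exists (e x) => //; apply/seteqP; split=> z.
  by move=> [y] /eP; apply.
by exists x.
Qed.

Definition act_kernel_normal : fin_normal (braid n) := {|
  fin_normal_set := act_kernel;
  fin_normal1 := braid_act1;
  fin_normalM := fun x y xK yK v => etrans (act_kernelM x yK v) (xK v);
  fin_normalV := act_kernelV;
  fin_normalJ := act_kernelJ;
  fin_normal_index := act_kernel_index
|}.

Lemma coset_nonempty (C : cosets act_kernel_normal) :
  exists x, left_coset act_kernel x = coset_set C.
Proof. by have [x _ xC] := set_valP C; exists x. Qed.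

Definition coset_fixed (C : cosets act_kernel_normal) : nat :=
  #|[pred v | braid_act (sval (cid (coset_nonempty C))) v == v]|.

Lemma coset_fixedE x :
  coset_fixed (to_coset act_kernel_normal x) = #|[pred v | braid_act x v == v]|.
Proof.
rewrite /coset_fixed; case: cid => y /= yx.
have /= [k kK <-] : left_coset act_kernel y x.
  by rewrite yx; exists 1%g; [exact: braid_act1|exact: mulg1].
by apply: eq_card => v; rewrite !inE act_kernelM.
Qed.

Lemma extension_exists : exists c, @is_extension Q n c.
Proof.
exists (coset_fixed \o @component _ act_kernel_normal); split.
  move=> x; apply: continuous_comp; first exact: component_continuous.
  by move=> A /nbhs_singleton; rewrite /nbhs /= => hA; apply/principal_filterP.
move=> w; rewrite card_Col_closure [LHS]coset_fixedE.
by apply: eq_card => v; rewrite !inE braid_act_pi.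
Qed.

End Extension.

(* Uniqueness of the extension: braids are dense in the completion. *)

Section Density.
Variable G : groupType.

Lemma left_cosetI (N M : set G) g :
  left_coset (N `&` M) g = left_coset N g `&` left_coset M g.
Proof.
apply/seteqP; split=> [_ [h [Nh Mh] <-]|_ [[h Nh <-] [k Mk]]].
  by split; exists h.
by move=> /mulgI kh; exists h => //; split=> //; rewrite -kh.
Qed.

Section Meet.
Variables N M : fin_normal G.

Fact fin_normalI_index : finite_set (range (left_coset (N `&` M))).
Proof.
apply: (@sub_finite_set _ _ ((fun C => C.1 `&` C.2) @`
    (range (left_coset N) `*` range (left_coset M)))).
  move=> _ [g _ <-]; exists (left_coset N g, left_coset M g).
    by split; exists g.
  by rewrite left_cosetI.
by apply/finite_image/finite_setX; apply: fin_normal_index.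
Qed.

Definition fin_normalI : fin_normal G.
Proof.
apply: (@FinNormal G (N `&` M)).
- by split; apply: fin_normal1.
- by move=> x y [? ?] [? ?]; split; apply: fin_normalM.
- by move=> x [? ?]; split; apply: fin_normalV.
- by move=> x y [? ?]; split; apply: fin_normalJ.
- exact: fin_normalI_index.
Defined.

End Meet.

Fact fin_normalT_subproof : finite_set (range (left_coset [set: G])).
Proof.
apply: (@sub_finite_set _ _ [set setT]) => // _ [g _ <-].
apply/seteqP; split=> // x _; exists (g^-1 * x)%g => //.
by rewrite mulVKg.
Qed.

Definition fin_normalT : fin_normal G.
Proof.
by apply: (@FinNormal G setT) => //; exact: fin_normalT_subproof.
Defined.

Lemma component_sub (N M : fin_normal G) (x y : profinite G) :
  N `<=` M -> component N x = component N y -> component M x = component M y.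
Proof.
move=> NM; have [fx fy] := (set_valP x, set_valP y).
have := (fx _ _ NM, fy _ _ NM); rewrite /component => -[xM yM] xy.
have [g _ gN] : range (left_coset N) (coset_set (set_val y N)) := set_valP _.
have gNg : coset_set (set_val y N) g.
  by rewrite -gN; exists 1%g; [exact: fin_normal1|rewrite mulg1].
have cM (z : cosets M) : coset_set z g -> coset_set z = left_coset M g.
  have [h _ <-] : range (left_coset M) (coset_set z) := set_valP _.
  move=> -[k Mk <-]; apply/seteqP; split=> _ [l Ml <-].
    exists (k^-1 * l)%g; last by rewrite -mulgA mulVKg.
    by apply: fin_normalM => //; apply: fin_normalV.
  exists (k * l)%g; last by rewrite mulgA.
  exact: fin_normalM.
suff E : coset_set (set_val x M) = coset_set (set_val y M) by exact: val_inj.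
by rewrite (cM _ (yM _ gNg)); apply/cM/xM; move: gNg; rewrite -xy.
Qed.

Lemma nbhs_profinite (x : profinite G) (A : set (profinite G)) : nbhs x A ->
  exists N : fin_normal G, forall y, component N y = component N x -> A y.
Proof.
case=> _ [[B Bop <-] /= Bx BA].
suff [N NB] : exists N : fin_normal G,
    forall y, component N y = component N x -> B (set_val y).
  by exists N => y /NB; exact: BA.
have [P [[QQ QfinP <-] [V JV Vx] PB]] := open_nbhs_nbhs (conj Bop Bx).
suff [N NV] : exists N : fin_normal G,
    forall y, component N y = component N x -> V (set_val y).
  by exists N => y /NV Vy; apply: PB; exists V.
have [L Lsub VL] := QfinP _ JV.
have {}Lsub U : U \in L -> exists N : fin_normal G,
    forall y, component N y = component N x -> U (set_val y).
  move=> UL; have /Lsub/set_mem[N _ [W Wop WU]] := UL.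
  exists N => y yx; rewrite -WU /=.
  have : U (set_val x) by move: Vx; rewrite -VL; apply.
  by rewrite -WU /=; move: yx; rewrite /component => ->.
have H (s : seq (set (prod_topology (@cosets G)))) : {subset s <= L} ->
    exists N : fin_normal G, forall U, U \in s ->
    forall y, component N y = component N x -> U (set_val y).
  elim: s => [|U s IHs] sL; first by exists fin_normalT.
  have [N NU] := Lsub U (sL _ (mem_head _ _)).
  have [|M Ms] := IHs; first by move=> W Ws; apply: sL; rewrite inE Ws orbT.
  exists (fin_normalI N M) => W; rewrite inE => /orP[/eqP ->|Ws] y yx.
    by apply: NU; apply: component_sub yx => z [].
  by apply: (Ms W Ws); apply: component_sub yx => z [].
have [N NL] := H (enum_fset L) (fun U UL => UL).
by exists N => y yx; rewrite -VL => U UL; exact: NL yx.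
Qed.

Lemma to_profinite_dense (x : profinite G) (N : fin_normal G) :
  exists g, component N (to_profinite g) = component N x.
Proof.
have [g _ gN] := set_valP (component N x).
by exists g; apply: val_inj.
Qed.

Lemma continuous_profinite_ext (c d : profinite G -> nat) :
  continuous c -> continuous d ->
  (forall g, c (to_profinite g) = d (to_profinite g)) -> c = d.
Proof.
move=> cc cd cdg; apply/funext => x.
have nc : nbhs x (c @^-1` [set c x]) by apply: cc; exact: discrete_set1.
have nd : nbhs x (d @^-1` [set d x]) by apply: cd; exact: discrete_set1.
have [N NA] := nbhs_profinite (filterI nc nd).
have [g gx] := to_profinite_dense x N.
by have [/= <- <-] := NA _ gx.
Qed.

End Density.

Lemma extension_unique (Q : finQuandleType) n
    (c d : profinite (braid n) -> nat) :
  is_extension Q c -> is_extension Q d -> c = d.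
Proof.
move=> [cc cE] [dc dE]; apply: continuous_profinite_ext => // x.
by rewrite -[x]reprK cE dE.
Qed.

Definition coloring_count (Q : finQuandleType) (n : nat) :
    profinite (braid n) -> nat :=
  sval (cid (extension_exists Q n)).
Arguments coloring_count : clear implicits.

Lemma coloring_countP (Q : finQuandleType) n :
  is_extension Q (coloring_count Q n).
Proof. exact: svalP (cid (extension_exists Q n)). Qed.

(* Main.v *)
Require Import Defs.
From mathcomp Require Import all_boot.
From mathcomp Require Import all_classical topology.

(** Both sides are continuous and braids are dense, so it suffices to compare
    them on closures of braid words. There they count the tuples fixed by the
    braid action, which commutes with quandle morphisms; applied to the two
    projections of [Q * R], this identifies the fixed tuples of [Q * R] with
    the pairs of fixed tuples. *)

(** Needed because negative letters act through [qdiv]. After applying the injective map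
    [qop (f x)], both sides become [f y]. *)
Lemma qdiv_morphism (Q R : quandleType) (f : Q -> R) :
  quandle_morphism f -> forall x y, f (qdiv x y) = qdiv (f x) (f y).
Proof.
by move=> fM x y; apply: (can_inj (qopK (f x))); rewrite qdivK -fM qdivK.
Qed.

(** A letter makes each new entry either an old one or a [qop] or [qdiv] of two old ones, all of
    which [f] respects. *)
Lemma act_morphism (Q R : quandleType) (f : Q -> R) n (w : braid_word n)
    (v : {ffun 'I_n -> Q}) : quandle_morphism f ->
  act w [ffun i => f (v i)] = [ffun i => f (act w v i)].
Proof.
move=> fM; rewrite /act; elim: w v => //= l w IHw v.
(* The induction hypothesis, taken at the tuple already moved by [l], leaves only the single letter
   [l]. *)
rewrite -IHw; congr foldl; apply/ffunP => i; rewrite !ffunE.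
case: ifP => // _; case: ifP => // _.
by case: l.2; rewrite ?fM ?qdiv_morphism.
Qed.

Lemma fst_morphism (Q R : quandleType) :
  quandle_morphism (fst : (Q * R)%type -> Q).
Proof. by []. Qed.

Lemma snd_morphism (Q R : quandleType) :
  quandle_morphism (snd : (Q * R)%type -> R).
Proof. by []. Qed.

Lemma act_prod_fixed (Q R : finQuandleType) n (w : braid_word n)
    (v : {ffun 'I_n -> (Q * R)%type}) :
  (act w v == v) =
  (act w [ffun i => (v i).1] == [ffun i => (v i).1]) &&
  (act w [ffun i => (v i).2] == [ffun i => (v i).2]).
Proof.
rewrite (act_morphism _ _ _ _ w v (fst_morphism Q R)).
rewrite (act_morphism _ _ _ _ w v (snd_morphism Q R)).
apply/eqP/andP => [-> //|[/eqP/ffunP v1 /eqP/ffunP v2]].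
apply/ffunP => i; have := v1 i; have := v2 i; rewrite !ffunE.
by case: (act w v i) (v i) => [? ?] [? ?] /= -> ->.
Qed.

Lemma card_Col_prod (Q R : finQuandleType) n (w : braid_word n) :
  card_Col (Q * R)%type (braid_closure w) =
  (card_Col Q (braid_closure w) * card_Col R (braid_closure w))%N.
Proof.
rewrite !card_Col_closure -cardX.
pose split (v : {ffun 'I_n -> (Q * R)%type}) :=
  ([ffun i => (v i).1], [ffun i => (v i).2]).
pose pair (p : {ffun 'I_n -> Q} * {ffun 'I_n -> R}) :
    {ffun 'I_n -> (Q * R)%type} := [ffun i => (p.1 i, p.2 i)].
have splitK : cancel split pair.
  by move=> v; apply/ffunP => i; rewrite !ffunE -surjective_pairing.
have pairK : cancel pair split.
  by move=> [a b]; congr (_, _); apply/ffunP => i; rewrite !ffunE.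
have splitI := can_inj splitK.
(* Injectivity of [split] preserves the count; writing [p] as [split (pair p)] then shows that the
   image is exactly the set of pairs of fixed tuples. *)
rewrite -(fintype.card_image splitI); apply: eq_card => p.
by rewrite -[p]pairK (fintype.mem_image splitI) !inE act_prod_fixed.
Qed.

(** As [nat] is discrete, [c] and [d] are both constant near [x], hence so is their product. *)
Lemma continuous_muln (T : topologicalType) (c d : T -> nat) :
  continuous c -> continuous d -> continuous (fun x => (c x * d x)%N).
Proof.
move=> cc cd x A /nbhs_singleton Ax.
have nc : nbhs x (c @^-1` [set c x])%classic by apply: cc; exact: discrete_set1.
have nd : nbhs x (d @^-1` [set d x])%classic by apply: cd; exact: discrete_set1.
by apply: filterS (filterI nc nd) => y [/= -> ->].
Qed.

Theorem proposition5p9 (Q R : finQuandleType) (n : nat) :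
  (fun x => (coloring_count Q n x * coloring_count R n x)%N) =
  coloring_count (Q * R)%type n.
Proof.
have [cQ eQ] := coloring_countP Q n; have [cR eR] := coloring_countP R n.
(* What remains is [is_extension] of the product function for [Q * R]: continuity, then its values
   on braid words. *)
apply: (extension_unique _ (coloring_countP _ n)); split.
  exact: continuous_muln.
by move=> w; rewrite eQ eR card_Col_prod.
Qed.
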